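(* Let $k\ge 3$ and $n\ge 2$ be integers and let $\mathcal{H}_{k,n}$ be the hinge graph obtained by gluing $n$ copies of the $k$-cycle along one common edge. Then the critical group of $\mathcal{H}_{k,n}$ has order $$|K(\mathcal{H}_{k,n})|=(k-1)^{n-2}(k-1)(k+n-1).$$
   Context: The hinge graph $\mathcal{H}_{k,n}$ is the simple graph with two distinguished (''shared'') vertices $x,y$ joined by an edge $xy$, together with $n$ internally vertex-disjoint paths from $x$ to $y$, each having $k-2$ internal vertices; equivalently, it is obtained from $n$ cycle graphs with $k$ vertices each by identifying one edge (and its two endpoints) of every cycle into a single common edge $xy$. For a finite connected graph $G$, a divisor is a formal $\mathbb{Z}$-linear combination of vertices; firing a vertex $w$ decreases its value by its valence and increases each neighbor's value by $1$; two divisors are linearly equivalent if one is obtained from the other by a sequence of firings and their inverses (i.e., their difference lies in the image of the graph Laplacian $L$). The critical group $K(G)$ is the group of degree-zero divisors modulo linear equivalence (the torsion part of $\operatorname{cok}(L)$). *)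

(* Defs.v *)
From HB Require Import structures.
From mathcomp Require Import all_boot all_order all_algebra.
From mathcomp Require Import boolp classical_sets cardinality.

Set Implicit Arguments.
Unset Strict Implicit.
Unset Printing Implicit Defensive.

Import GRing.Theory.
Local Open Scope ring_scope.
Local Open Scope quotient_scope.

Record sgraph := SGraph {
  vertex :> finType;
  adj : rel vertex;
  adj_sym : symmetric adj;
  adj_irr : irreflexive adj }.

Definition valence (G : sgraph) (v : G) : nat := #|[pred w | adj v w]|.

Notation divisor G := {ffun vertex G -> int}.

Definition degree (G : sgraph) (D : divisor G) : int := \sum_v D v.

Definition fire (G : sgraph) (w : G) (D : divisor G) : divisor G :=
  [ffun v => if v == w then D v - (valence w)%:Z
             else if adj w v then D v + 1 else D v].

(* Sequences of firings and of inverse firings. *)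
Inductive lin_equiv (G : sgraph) (D : divisor G) : divisor G -> Prop :=
| LinRefl : lin_equiv D D
| LinFire w D' : lin_equiv D D' -> lin_equiv D (fire w D')
| LinUnfire w D' : lin_equiv D (fire w D') -> lin_equiv D D'.

Definition laplacian (G : sgraph) (f : divisor G) : divisor G :=
  [ffun v => (valence v)%:Z * f v - \sum_(w | adj v w) f w].

Section CriticalGroup.
Variable G : sgraph.
Implicit Types (D f : divisor G).

Lemma degreeB : {morph @degree G : D D' / D - D'}.
Proof.
by move=> D D'; rewrite /degree -sumrB; apply: eq_bigr => v _; rewrite !ffunE.
Qed.

Lemma laplacianB : {morph @laplacian G : f f' / f - f'}.
Proof.
move=> f f'; apply/ffunP => v; rewrite !ffunE mulrBr.
under eq_bigr do rewrite !ffunE.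
by rewrite sumrB opprB opprB addrACA [RHS]addrACA; congr (_ + _); rewrite addrC.
Qed.

Definition degree_zero : {pred divisor G} := [pred D | degree D == 0].

Fact degree_zero_zmod_closed : zmod_closed degree_zero.
Proof.
split=> [|D D']; rewrite !inE.
  by rewrite /degree big1 // => v _; rewrite ffunE.
by move=> /eqP D0 /eqP D'0; rewrite degreeB D0 D'0 subr0.
Qed.

HB.instance Definition _ :=
  GRing.isZmodClosed.Build (divisor G) degree_zero degree_zero_zmod_closed.

Record divisor0 := Divisor0 {
  divisor0_val :> divisor G;
  _ : divisor0_val \in degree_zero }.

HB.instance Definition _ := [isSub for divisor0_val].
HB.instance Definition _ := [Choice of divisor0 by <:].
HB.instance Definition _ := [SubChoice_isSubZmodule of divisor0 by <:].

Definition principal : {pred divisor0} :=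
  [pred D : divisor0 | `[< exists f, val D = laplacian f >]].

Fact principal_zmod_closed : zmod_closed principal.
Proof.
split=> [|D D'].
  apply/asboolP; exists 0; rewrite -[in RHS](subrr 0) laplacianB subrr.
  exact: raddf0.
move=> /asboolP[f Df] /asboolP[f' Df']; apply/asboolP; exists (f - f').
by rewrite laplacianB -Df -Df' raddfB.
Qed.

HB.instance Definition _ :=
  GRing.isZmodClosed.Build divisor0 principal principal_zmod_closed.

Definition critical_group : zmodType := Quotient.quot principal.

End CriticalGroup.

(* inl false is x, inl true is y, and inr (i, j) is the j-th internal vertex of
   the i-th path, counted from x. *)
Definition hinge_vertex (k n : nat) : finType :=
  (bool + 'I_n * 'I_(k - 2))%type.

Definition hinge_arc (k n : nat) (u v : hinge_vertex k n) : bool :=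
  match u, v with
  | inl false, inl true => true
  | inl false, inr (_, j) => (j == 0 :> nat)%N
  | inr (i, j), inr (i', j') => (i == i') && (j.+1 == j' :> nat)%N
  | inr (_, j), inl true => (j.+1 == k - 2)%N
  | _, _ => false
  end.

Definition hinge_adj (k n : nat) : rel (hinge_vertex k n) :=
  [rel u v | hinge_arc u v || hinge_arc v u].

Fact hinge_adj_sym k n : symmetric (@hinge_adj k n).
Proof. by move=> u v; exact: orbC. Qed.

Fact hinge_adj_irr k n : irreflexive (@hinge_adj k n).
Proof. by case=> [[]|[i j]] //=; rewrite /hinge_adj /= orbb gtn_eqF ?andbF. Qed.

Definition hinge (k n : nat) : sgraph :=
  SGraph (@hinge_adj_sym k n) (@hinge_adj_irr k n).

Section LinearEquivalence.
Variable G : sgraph.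
Implicit Types (D f : divisor G).

Let delta (w : G) : divisor G := [ffun v => (v == w)%:Z].

Lemma fireE w D : fire w D = D - laplacian (delta w).
Proof.
apply/ffunP => v; rewrite !ffunE.
have -> : \sum_(u | adj v u) delta w u = (adj v w)%:Z.
  rewrite big_mkcond (bigD1 w) //= ffunE eqxx big1 ?addr0; first by case: adj.
  by move=> u /negPf uw; rewrite ffunE uw if_same.
have [->|_] := eqVneq v w; first by rewrite adj_irr mulr1 subr0.
by rewrite mulr0 sub0r opprK adj_sym; case: adj; rewrite ?addr0.
Qed.

Lemma deltaMz w v (z : int) : (delta w *~ z) v = z * (v == w)%:Z.
Proof.
case: z => m; rewrite ?NegzE ?mulrNz -?pmulrn ?ffunE ffunMnE ffunE.
  by rewrite -mulr_natl natz.
by rewrite mulNr -mulr_natl natz.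
Qed.

Lemma lin_equiv_trans D1 D2 D3 :
  lin_equiv D1 D2 -> lin_equiv D2 D3 -> lin_equiv D1 D3.
Proof.
move=> D12; elim=> // w D; first by move=> _; apply: LinFire.
by move=> _; apply: LinUnfire.
Qed.

Lemma lin_equiv_laplacian D D' :
  lin_equiv D D' <-> exists f, D - D' = laplacian f.
Proof.
have L0 : laplacian (0 : divisor G) = 0.
  by rewrite -[in LHS](subrr 0) laplacianB subrr.
have LN f : laplacian (- f) = - laplacian f.
  by rewrite -sub0r laplacianB L0 sub0r.
split.
  elim=> [|w {}D' _ [f fP]|w {}D' _ [f fP]].
  - by exists 0; rewrite subrr L0.
  - exists (f - - delta w).
    by rewrite laplacianB LN -fP fireE opprB opprK addrA addrAC.
  - exists (f - delta w); rewrite laplacianB -fP fireE.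
    by rewrite opprB addrA [RHS]addrAC addrK.
pose P f := forall E, lin_equiv E (E - laplacian f).
have PD f g : P f -> P g -> P (f + g).
  move=> Pf Pg E; rewrite -[g]opprK laplacianB LN opprK opprD addrA.
  exact: lin_equiv_trans (Pf E) (Pg _).
have P0 : P 0 by move=> E; rewrite L0 subr0; apply: LinRefl.
have Pdelta w : P (delta w).
  by move=> E; rewrite -fireE; apply/LinFire/LinRefl.
have PNdelta w : P (- delta w).
  move=> E; apply: (LinUnfire (w := w)).
  by rewrite fireE LN opprK addrK; apply: LinRefl.
have PMn f m : P f -> P (f *+ m).
  by move=> Pf; elim: m => [|m IHm]; rewrite ?mulr0n // mulrSr; apply: PD.
case=> f DD'; rewrite -[D'](subKr D) DD'.
suff: P f by apply.
have -> : f = \sum_(w : G) delta w *~ f w.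
  apply/ffunP => v; rewrite sum_ffunE (bigD1 v) //= big1 ?addr0.
    by rewrite deltaMz eqxx mulr1.
  by move=> u /negPf uv; rewrite deltaMz eq_sym uv mulr0.
elim/big_ind: _ => // w _; case: (f w) => m; first exact: PMn.
by rewrite NegzE mulrNz -mulNrn; apply: PMn.
Qed.

Lemma critical_group_eqP (D D' : divisor0 G) :
  reflect (lin_equiv (val D) (val D'))
    (D == D' %[mod critical_group G]).
Proof.
rewrite -Quotient.idealrBE inE.
apply: (iffP (asboolP _)) => [|/lin_equiv_laplacian]; rewrite raddfB //.
by move=> /lin_equiv_laplacian.
Qed.

End LinearEquivalence.

(* Main.v *)
(** A degree-zero divisor [D] on the hinge graph is recorded by its value at
    [y] and by the moments [S_i], the sums over the [i]-th path of the distance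
    to [x] times [D]. With [m = k - 1], summation by parts shows that [D] is
    principal iff [S_i = t + m e_i] and [D y = t - sum_i e_i] for some integers
    [t], [e_i] ([t] being the difference of potential between [y] and [x]).
    Hence the class of [D] is determined by the residues mod [m] of the
    [S_i - S_0], for [i > 0], together with the residue mod [m + n] of
    [D y - S_0 + sum_i ((S_i - S_0) div m)], and all these
    [m ^ (n - 1) * (m + n)] values occur. *)
Require Import Defs.
From mathcomp Require Import all_boot all_order all_algebra.
From mathcomp Require Import boolp classical_sets cardinality.
From mathcomp Require Import ring zify.

Set Implicit Arguments.
Unset Strict Implicit.
Unset Printing Implicit Defensive.

Import GRing.Theory.
Local Open Scope ring_scope.

(** * Counting divisor classes by a complete invariant *)

Lemma card_critical_group (G : sgraph) (T : finType) (phi : divisor0 G -> T) :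
    (forall D D', phi D = phi D' <-> exists f, val D - val D' = laplacian f) ->
    (forall a, exists D, phi D = a) ->
  ([set: critical_group G] #= `I_#|T|)%classic%card.
Proof.
move=> phiP phi_surj; apply/card_set_bijP.
have piP (D D' : divisor0 G) :
    \pi_(critical_group G)%qT D = \pi_(critical_group G)%qT D' <-> phi D = phi D'.
  rewrite phiP; split=> [/eqP/critical_group_eqP/lin_equiv_laplacian //|].
  by move=> /lin_equiv_laplacian/critical_group_eqP/eqP.
(* The bijection numbers the value of [phi] at the chosen representative of each class. *)
exists (fun q => enum_rank (phi (repr q)) : nat); split=> /=.
- by move=> q _ /=; apply: ltn_ord.
- move=> q q' _ _ /val_inj/enum_rank_inj/piP.
  by rewrite !reprK.
- move=> i /= iT; have [D phiD] := phi_surj (enum_val (Ordinal iT)).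
  exists (\pi_(critical_group G)%qT D) => //=.
  have /piP -> : \pi_(critical_group G)%qT (repr (\pi_(critical_group G)%qT D))
    = \pi_(critical_group G)%qT D by rewrite reprK.
  by rewrite phiD enum_valK.
Qed.

(** * Degree and Laplacian on an arbitrary graph *)

Lemma laplacianE (G : sgraph) (f : divisor G) v :
  laplacian f v = \sum_(w | adj v w) (f v - f w).
Proof. by rewrite ffunE sumrB sumr_const -mulr_natl natz. Qed.

Lemma degree_laplacian (G : sgraph) (f : divisor G) : degree (laplacian f) = 0.
Proof.
rewrite /degree; under eq_bigr do rewrite laplacianE sumrB big_mkcond /=.
rewrite sumrB; apply/eqP; rewrite subr_eq0; apply/eqP.
rewrite [RHS](eq_bigr (fun v => \sum_w if adj v w then f w else 0)); last first.
  by move=> v _; rewrite big_mkcond.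
rewrite [RHS]exchange_big; apply: eq_bigr => v _; apply: eq_bigr => w _.
by rewrite adj_sym.
Qed.

(** The degree determines the one missing value, so a Laplacian need not be computed at [x]. *)
Lemma eq_divisor_off (G : sgraph) (x : G) (D D' : divisor G) :
  degree D = degree D' -> (forall v, v != x -> D v = D' v) -> D = D'.
Proof.
move=> degDD' DD'; apply/ffunP => v; have [->|/DD' //] := eqVneq v x.
move: degDD'; rewrite /degree (bigD1 x) //= [RHS](bigD1 x) //=.
by rewrite (eq_bigr D') // => /addIr.
Qed.

(** * Second differences of integer sequences *)

Definition second_diff (g : nat -> int) (j : nat) : int :=
  2 * g j.+1 - g j - g j.+2.

(** Summation by parts: the linear weight has zero second difference, so only boundary terms
    survive. *)
Lemma sum_second_diff (g : nat -> int) N :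
  \sum_(j < N) j.+1%:Z * second_diff g j
    = N.+1%:Z * (g N - g N.+1) + (g N.+1 - g 0%N).
Proof.
elim: N => [|N IHN]; first by rewrite big_ord0; ring.
by rewrite big_ord_recr /= IHN /second_diff !intS; ring.
Qed.

Lemma second_diff_forward (h : nat -> int) a b :
  exists g, [/\ g 0%N = a, g 1%N = b & forall j, second_diff g j = h j].
Proof.
(* [s j] carries the pair of values at [j] and [j.+1]. *)
pose s := iteri _ (fun j u => (u.2, 2 * u.2 - u.1 - h j)) (a, b).
exists (fun j => (s j).1); split=> // j; rewrite /second_diff /s /=; ring.
Qed.

(** Second differences are invariant under reversal, so the forward recursion is run on reversed
    data. *)
Lemma second_diff_backward (h : nat -> int) N a b :
  exists g, [/\ g N.+1 = a, g N = b &
    forall j, (j < N)%N -> second_diff g j = h j].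
Proof.
have [g [ga gb gh]] := second_diff_forward (fun j => h (N.-1 - j)%N) a b.
exists (fun j => g (N.+1 - j)%N); split; rewrite ?subnn ?subSnn // => j jN.
rewrite (_ : h j = second_diff g (N.-1 - j)).
  rewrite /second_diff (_ : N.+1 - j = (N.-1 - j).+2)%N; last by lia.
  rewrite (_ : N.+1 - j.+1 = (N.-1 - j).+1)%N; last by lia.
  by rewrite (_ : N.+1 - j.+2 = N.-1 - j)%N; [ring|lia].
by rewrite gh; congr h; lia.
Qed.

(** * Principal divisors on the hinge graph *)

Section Hinge.
Variables k n : nat.
Hypothesis k_gt2 : (2 < k)%N.
Implicit Types (D f : divisor (hinge k n)) (i : 'I_n).

Let N := (k - 2)%N.
Let m := N.+1.

Let hx : hinge k n := inl false.
Let hy : hinge k n := inl true.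
Let hp i (j : 'I_(k - 2)) : hinge k n := inr (i, j).

Definition hinge_divisor (a b : int) (c : 'I_n -> 'I_(k - 2) -> int) :
    divisor (hinge k n) :=
  [ffun v : hinge k n => match v : bool + 'I_n * 'I_(k - 2) return int with
    | inl false => a | inl true => b | inr p => c p.1 p.2 end].

Lemma big_hinge (P : pred (hinge k n)) (F : hinge k n -> int) :
  \sum_(v | P v) F v = (if P hx then F hx else 0) + (if P hy then F hy else 0)
    + \sum_i \sum_(j | P (hp i j)) F (hp i j).
Proof.
rewrite big_mkcond big_sumType /= big_bool /=; congr (_ + _).
  by rewrite addrC.
rewrite [RHS](eq_bigr (fun i => \sum_j if P (hp i j) then F (hp i j) else 0)).
  by rewrite pair_bigA /= big_mkcond; apply: eq_bigr => -[].
by move=> i _; rewrite -big_mkcond.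
Qed.

(* The values of [f] at the successive vertices of the [i]-th path, from [hx] at
   index [0] to [hy] at index [k - 1] (and beyond). *)
Definition along f i (p : nat) : int :=
  if p is p'.+1 then
    if insub p' is Some j then f (hp i j) else f hy
  else f hx.

Lemma alongS f i (j : 'I_(k - 2)) : along f i j.+1 = f (hp i j).
Proof. by rewrite /= valK. Qed.

Lemma along_last f i : along f i m = f hy.
Proof. by rewrite /= insubF // ltnn. Qed.

Lemma sum_pick (p : nat) (F : 'I_(k - 2) -> int) :
  \sum_(j < k - 2 | p == j) F j = if insub p is Some j then F j else 0.
Proof.
case: insubP => [j _ jp|pN].
  by rewrite (big_pred1 j) // => j'; rewrite -jp eq_sym.
by rewrite big_pred0 // => j; apply: contraNF pN => /eqP ->.
Qed.

Lemma laplacian_path f i (j : 'I_(k - 2)) :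
  laplacian f (hp i j) = second_diff (along f i) j.
Proof.
rewrite laplacianE big_hinge /= (bigD1 i) //= [X in _ + (_ + X)]big1; last first.
  move=> i' /negPf ii'; rewrite big_pred0 // => j'.
  by rewrite /hinge_adj /= ii' eq_sym ii'.
rewrite addr0 /hinge_adj /= !eqxx /=.
(* Neighbours inside the path split into successor and predecessor of [j]; at an end, the missing
   one is [hy] or [hx], counted separately. *)
rewrite (bigID (fun j' : 'I_(k - 2) => j.+1 == j')) /=.
rewrite (eq_bigl (fun j' : 'I_(k - 2) => j.+1 == j')); last first.
  by move=> j'; rewrite andbC; case: eqP.
rewrite [X in _ + (_ + X)](eq_bigl (fun j' : 'I_(k - 2) => j'.+1 == j)).
  2: by move=> j'; case: eqP => [<-|] /=; [symmetry; apply/eqP; lia|rewrite andbT].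
rewrite /second_diff alongS /= sum_pick orbF.
have jN := ltn_ord j.
have -> : \sum_(j' < k - 2 | j'.+1 == j) (f (hp i j) - f (hp i j'))
    = if val j is p.+1 then f (hp i j) - along f i p.+1 else 0.
  case: j jN => -[|p] pN /= _; first by rewrite big_pred0.
  have pN' : (p < k - 2)%N by lia.
  by rewrite insubT (big_pred1 (Ordinal pN')).
case: insubP => [j' /= _ j'E|/= jlast].
  rewrite (_ : (j.+1 == _) = false); last by have := ltn_ord j'; lia.
  by case: (val j) => [|p] /=; ring.
rewrite (_ : (j.+1 == _)); last by lia.
by case: (val j) => [|p] /=; ring.
Qed.

Lemma laplacian_hy f :
  laplacian f hy = (f hy - f hx) - \sum_i (along f i N - f hy).
Proof.
rewrite laplacianE big_hinge /= addr0 -sumrN; congr (_ + _).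
apply: eq_bigr => i _; rewrite /N.
have lastP : ((k - 2).-1 < k - 2)%N by lia.
rewrite (big_pred1 (Ordinal lastP)); last first.
  move=> j; rewrite /hinge_adj /= -val_eqE /=.
  by apply/eqP/eqP; lia.
have -> : along f i (k - 2) = f (hp i (Ordinal lastP)).
  by rewrite -alongS; congr along; rewrite /=; lia.
by rewrite opprB.
Qed.

Definition moment D i : int := \sum_(j < k - 2) j.+1%:Z * D (hp i j).

Lemma momentB D D' i : moment (D - D') i = moment D i - moment D' i.
Proof.
by rewrite /moment -sumrB; apply: eq_bigr => j _; rewrite !ffunE mulrBr.
Qed.

Lemma moment_laplacian f i :
  moment (laplacian f) i = (f hy - f hx) + m%:Z * (along f i N - f hy).
Proof.
rewrite /moment; under eq_bigr do rewrite laplacian_path.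
by rewrite sum_second_diff along_last addrC.
Qed.

(** Here [e i] is the potential at the last internal vertex of path [i] minus that at [hy]. *)
Lemma hinge_principalP D : degree D = 0 ->
  (exists f, D = laplacian f) <->
  (exists t (e : 'I_n -> int), (forall i, moment D i = t + m%:Z * e i) /\
    D hy = t - \sum_i e i).
Proof.
move=> degD; split=> [[f ->]|[t [e [De Dy]]]].
  exists (f hy - f hx), (fun i => along f i N - f hy); split.
    exact: moment_laplacian.
  exact: laplacian_hy.
pose h i (p : nat) := if insub p is Some j then D (hp i j) else 0.
(* With potential 0 at [hx], [hy] gets [t]; each path is solved starting from its [hy] end. *)
have /choice[g gP] i := second_diff_backward (h i) N t (t + e i).
have gm i : g i m = t by case: (gP i).
have gN i : g i N = t + e i by case: (gP i).
have gD i (j : 'I_(k - 2)) : second_diff (g i) j = D (hp i j).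
  by case: (gP i) => _ _ ->; rewrite ?ltn_ord // /h valK.
(* The moment condition is exactly what makes every path reach the value 0 at [hx]. *)
have g0 i : g i 0%N = 0.
  have := sum_second_diff (g i) N; rewrite gm gN.
  under eq_bigr do rewrite gD.
  by rewrite -/(moment D i) De /m; lia.
pose f := hinge_divisor 0 t (fun i j => g i j.+1).
have fx : f hx = 0 by rewrite ffunE.
have fy : f hy = t by rewrite ffunE.
have fE i p : (p <= m)%N -> along f i p = g i p.
  case: p => [|p] pm /=; first by rewrite fx g0.
  case: insubP => [j _ <-|pN]; first by rewrite ffunE.
  by rewrite fy -(gm i); congr (g i _); rewrite /m /N in pm *; lia.
exists f; apply: (@eq_divisor_off _ hx); first by rewrite degree_laplacian.
case=> [[] // _|[i j] _].
  rewrite -/hy laplacian_hy Dy fx fy subr0; congr (_ - _).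
  by apply: eq_bigr => i _; rewrite fE // gN; ring.
rewrite -/(hp i j) laplacian_path -gD; have := ltn_ord j.
by rewrite /second_diff => jN; rewrite !fE // /m /N; lia.
Qed.

Lemma moment_surj (S : 'I_n -> int) (d : int) :
  exists D : divisor0 (hinge k n), (forall i, moment (val D) i = S i) /\ val D hy = d.
Proof.
(* The mass [S i] sits at distance 1 from [hx], where the moment weight is 1; [hx] balances the
   degree. *)
pose D := hinge_divisor (- (d + \sum_i S i)) d
  (fun i j => if val j == 0%N then S i else 0).
have N_gt0 : (0 < k - 2)%N by lia.
have Dp i (w : 'I_(k - 2) -> int) :
    \sum_(j < k - 2) w j * D (hp i j) = w (Ordinal N_gt0) * S i.
  rewrite (bigD1 (Ordinal N_gt0)) //= ffunE /= big1 ?addr0 // => j.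
  by rewrite ffunE -val_eqE /= => /negPf ->; rewrite mulr0.
have degD : D \in @degree_zero (hinge k n).
  rewrite inE /degree big_hinge /=.
  under eq_bigr => i _ do under eq_bigr do rewrite -[D _]mul1r.
  under eq_bigr do rewrite Dp mul1r.
  by rewrite !ffunE /= -addrA addNr.
exists (Divisor0 degD); split=> [i|]; last by rewrite /= ffunE.
by rewrite /moment /= Dp mul1r.
Qed.

End Hinge.

(** * Integer residues and quotients *)

Definition residue (p : nat) (z : int) : 'I_p.+1 := inord `|(z %% p.+1)%Z|.

Lemma residueP p z z' :
  residue p z = residue p z' <-> (z %% p.+1)%Z = (z' %% p.+1)%Z.
Proof.
rewrite /residue; split=> [/(congr1 val)|->//].
have lt_mod y : (`|(y %% p.+1)%Z| < p.+1)%N by lia.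
by rewrite /= !inordK //; lia.
Qed.

Lemma residue_ord p (i : 'I_p.+1) : residue p i%:Z = i.
Proof.
by rewrite /residue modz_small ?inord_val //= ltz_nat ltn_ord.
Qed.

Lemma modz_eqP (d : nat) (z z' : int) :
  (z %% d.+1)%Z = (z' %% d.+1)%Z <-> exists c, z - z' = d.+1%:Z * c.
Proof.
split=> [/eqP|[c zz']]; last by apply/eqP; rewrite eqz_mod_dvd zz' dvdz_mulr.
by rewrite eqz_mod_dvd => /dvdzP[c ->]; exists c; rewrite mulrC.
Qed.

Lemma divzB_eq (d : nat) (z z' c : int) :
  z - z' = d.+1%:Z * c -> (z %/ d.+1)%Z - (z' %/ d.+1)%Z = c.
Proof.
move=> /eqP; rewrite subr_eq mulrC => /eqP ->.
by rewrite divzMDl // addrK.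
Qed.

(** * The complete invariant of a divisor class *)

Section HingeClass.
Variables k n : nat.
Hypothesis k_gt2 : (2 < k)%N.
Implicit Types D : divisor0 (hinge k n.+1).

Let m := (k - 2).+1.

(** Adding a principal divisor with parameters [t], [e] changes the three terms by [t - \sum_i e i],
    [-(t + m * e ord0)] and [\sum_i (e i - e ord0)]: in total [-(m + n.+1) * e ord0]. *)
Definition carry D : int :=
  val D (inl true) - moment (val D) ord0
    + \sum_i ((moment (val D) i - moment (val D) ord0) %/ m)%Z.

Definition hinge_class D : {ffun 'I_n -> 'I_m} * 'I_(m + n.+1) :=
  ([ffun i => residue (k - 2) (moment (val D) (lift ord0 i) - moment (val D) ord0)],
   residue (k - 2 + n.+1) (carry D)).

Lemma hinge_classP D D' :
  hinge_class D = hinge_class D' <-> exists f, val D - val D' = laplacian f.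
Proof.
have degDD' : degree (val D - val D') = 0.
  by rewrite degreeB; case: D D' => [D] /= /eqP -> [D'] /= /eqP ->.
rewrite hinge_principalP //.
set S := moment (val D); set S' := moment (val D').
split=> [[/ffunP rE]|].
  move=> /residueP/modz_eqP[c cE].
  have {}cE : carry D - carry D' = (m%:Z + n.+1%:Z) * c by rewrite cE -PoszD.
  have /choice[q qE] i : exists q, (S i - S ord0) - (S' i - S' ord0) = m%:Z * q.
    case: (unliftP ord0 i) => [i'|] ->; last by exists 0; ring.
    by apply/modz_eqP/residueP; have := rE i'; rewrite !ffunE.
  (* Since [q ord0 = 0], the carry forces [e ord0 = - c]; the moment of path [ord0] then gives
     [t]. *)
  exists (S ord0 - S' ord0 + m%:Z * c), (fun i => q i - c); split=> [i|].
    by rewrite momentB -/(S i) -/(S' i); have := qE i; rewrite -/m; lia.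
  have: \sum_i ((S i - S ord0) %/ m)%Z - \sum_i ((S' i - S' ord0) %/ m)%Z
      = \sum_i q i.
    by rewrite -sumrB; apply: eq_bigr => i _; apply/divzB_eq/qE.
  rewrite sumrB sumr_const card_ord !ffunE -mulr_natl.
  move: cE; rewrite natz /carry -/S -/S'.
  move: (\sum_i _) (\sum_i _) (\sum_i _) (val D _) (val D' _) => A B C d d'.
  lia.
move=> [t [e [Se Sy]]].
have SE i : S i - S' i = t + m%:Z * e i by rewrite -Se momentB.
have qE i : (S i - S ord0) - (S' i - S' ord0) = m%:Z * (e i - e ord0).
  by have := SE i; have := SE ord0; lia.
congr pair.
  apply/ffunP => i; rewrite !ffunE; apply/residueP/modz_eqP.
  by exists (e (lift ord0 i) - e ord0).
apply/residueP/modz_eqP; exists (- e ord0).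
suff: carry D - carry D' = (m%:Z + n.+1%:Z) * - e ord0 by rewrite -PoszD.
rewrite /carry -/S -/S'.
have: \sum_i ((S i - S ord0) %/ m)%Z - \sum_i ((S' i - S' ord0) %/ m)%Z
    = \sum_i (e i - e ord0).
  by rewrite -sumrB; apply: eq_bigr => i _; apply/divzB_eq/qE.
rewrite sumrB sumr_const card_ord -mulr_natl natz.
move: Sy (SE ord0); rewrite !ffunE.
move: (\sum_i _) (\sum_i _) (\sum_i _) (val D _) (val D' _) => A B C d d'.
lia.
Qed.

(** Taking [S ord0 = 0] and the other moments in [[0, m)] makes all quotients vanish, so the carry
    is just the value at [y]. *)
Lemma hinge_class_surj a : exists D, hinge_class D = a.
Proof.
case: a => r c.
pose S (i : 'I_n.+1) : int := if unlift ord0 i is Some i' then (r i')%:Z else 0.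
have S0 : S ord0 = 0 by rewrite /S unlift_none.
have [D [DS Dy]] := moment_surj k_gt2 S c%:Z; exists D; congr pair.
  by apply/ffunP => i; rewrite ffunE !DS S0 /S liftK subr0 residue_ord.
rewrite /carry DS S0 Dy big1 ?addr0 ?subr0 ?residue_ord // => i _.
rewrite DS subr0 /S divz_small //; case: unlift => [i'|] //=.
by rewrite ltz_nat ltn_ord.
Qed.

End HingeClass.

Local Close Scope ring_scope.

Theorem theorem3p1 (k n : nat) (hk : 3 <= k) (hn : 2 <= n) :
  ([set: critical_group (hinge k n)]
     #= `I_((k - 1) ^ (n - 2) * ((k - 1) * (k + n - 1))))%classic%card.
Proof.
(* Writing the number of paths as a successor provides the base path [ord0]; the other [n] paths
   each contribute a factor [k - 1]. *)
case: n hn => [|n] // hn.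
have -> : ((k - 1) ^ (n.+1 - 2) * ((k - 1) * (k + n.+1 - 1)))%N
    = #|{: {ffun 'I_n -> 'I_(k - 2).+1} * 'I_((k - 2).+1 + n.+1)}|.
  rewrite card_prod card_ffun !card_ord mulnA -expnSr.
  by congr (_ ^ _ * _)%N; lia.
exact: card_critical_group (hinge_classP hk) (hinge_class_surj hk).
Qed.
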